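(* Suppose that $\mu_F+\mu_R>0$, and let $x^\star$ be the unique minimizer of $F(x)+R(x)+H(Kx)$ over $x\in\mathcal{X}$. Let $\kappa\in(0,1)$ and $\gamma_0\in(0,2(1-\kappa)/L_F)$. Set $\gamma_1=\gamma_0$ and $$\gamma_{k+1}=\frac{-\gamma_k^2\mu_F\kappa+\gamma_k\sqrt{(\gamma_k\mu_F\kappa)^2+1+2\gamma_k\mu_R}}{1+2\gamma_k\mu_R},\quad\text{for every }k\geq 1.$$ Suppose that $\eta\geq\|K\|^2$. Then in the PD3O algorithm with these stepsizes, there exists $c_0>0$ such that, for every $k\geq 1$, $$\|x^{k+1}-x^\star\|^2\leq\frac{\gamma_{k+1}^2}{1-\gamma_{k+1}\mu_F\kappa}\,c_0=O\big(1/k^2\big),$$ where the expression of the constant $c_0$ is $$c_0=\frac{1-\gamma_0\mu_F\kappa}{\gamma_0^2}\|x^1-x^\star\|^2+\big\|q^0-\tfrac{1}{\gamma_0}x^1-K^*(u^0-u^\star)+\nabla F(x^\star)\big\|^2+\eta\|u^0-u^\star\|^2-\|K^*(u^0-u^\star)\|^2,$$ with $u^\star$ any solution of the dual problem of minimizing $(F+R)^*(-K^*u)+H^*(u)$ over $u\in\mathcal{U}$; that is, $u^\star\in\partial H(Kx^\star)$ and $0\in\partial R(x^\star)+\nabla F(x^\star)+K^*u^\star$.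
   Context: $\mathcal{X}$ and $\mathcal{U}$ are finite-dimensional real Hilbert spaces, $K:\mathcal{X}\to\mathcal{U}$ is a linear operator with adjoint $K^*$ and operator norm $\|K\|$. $R:\mathcal{X}\to\mathbb{R}\cup\{+\infty\}$ and $H:\mathcal{U}\to\mathbb{R}\cup\{+\infty\}$ are proper, closed, convex functions, and $F:\mathcal{X}\to\mathbb{R}$ is convex and $L_F$-smooth (differentiable with $L_F$-Lipschitz gradient) for some $L_F>0$. For a function $G$, $\mu_G\geq0$ denotes some constant such that $G$ is $\mu_G$-strongly convex, i.e. $G-\frac{\mu_G}{2}\|\cdot\|^2$ is convex; $G^*$ is the convex conjugate and $\mathrm{prox}_G(z)=\arg\min_{z'}\{G(z')+\frac12\|z-z'\|^2\}$. Standing assumption: there exists $x^\star\in\mathcal{X}$ such that $0\in\nabla F(x^\star)+\partial R(x^\star)+K^*\partial H(Kx^\star)$. PD3O algorithm: given positive stepsizes $(\gamma_k)_{k\in\mathbb{N}}$, $\eta>0$ with $\eta\geq\|K\|^2$, $q^0\in\mathcal{X}$, $u^0\in\mathcal{U}$, for $k=0,1,\ldots$ iterate $$x^{k+1}=\mathrm{prox}_{\gamma_k R}\big(\gamma_k(q^k-K^*u^k)\big),\qquad q^{k+1}=\tfrac{1}{\gamma_{k+1}}x^{k+1}-\nabla F(x^{k+1}),$$ $$u^{k+1}=\mathrm{prox}_{H^*/(\gamma_{k+1}\eta)}\Big(u^k+\tfrac1\eta K\big(\tfrac{1}{\gamma_k}x^{k+1}+q^{k+1}-q^k\big)\Big)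.$$
   Formalization: With the explicit c_0 the printed bound is false: it is proved with denominator 1-2γ_{k+1}μ_Fκ, and c_0≥0 (it can be 0); the printed denominator is kept for some unspecified c_0>0. If X={0}, μ_F≤L_F is assumed. *)

(* Defs.v *)
From HB Require Import structures.
From mathcomp Require Import all_boot all_order all_algebra.
From mathcomp Require Import all_classical all_reals all_analysis.
Set Implicit Arguments.
Unset Strict Implicit.
Unset Printing Implicit Defensive.
Import Order.TTheory GRing.Theory Num.Theory.
Import numFieldNormedType.Exports.
Local Open Scope classical_set_scope.
Local Open Scope ring_scope.

(* Finite-dimensional real Hilbert spaces.  Finite dimension comes from the
   Vector structure; completeness is then automatic. *)
HB.mixin Record isInnerProduct (R : realType) E of NormedModule R E := {
  inner : E -> E -> R;
  innerC : forall x y, inner x y = inner y x;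
  innerDl : forall x y z, inner (x + y) z = inner x z + inner y z;
  innerZl : forall (a : R) x y, inner (a *: x) y = a * inner x y;
  inner_norm : forall x, `|x| ^+ 2 = inner x x }.

#[short(type="euclideanType")]
HB.structure Definition Euclidean (R : realType) :=
  { E of isInnerProduct R E & NormedModule R E & Vector R E }.

Section convex_analysis.
Context {R : realType}.
Local Open Scope ereal_scope.

Definition proper (T : Type) (f : T -> \bar R) : Prop :=
  (forall x, f x != -oo) /\ (exists x, f x < +oo).

(* Only meant for functions avoiding -oo; then the right-hand side is never an
   indeterminate sum, and 0 * +oo = 0 makes t = 0 and t = 1 harmless. *)
Definition econvex (E : lmodType R) (f : E -> \bar R) : Prop :=
  forall (x y : E) (t : R), (0 <= t <= 1)%R ->
    f (t *: x + (1 - t) *: y)%R <= t%:E * f x + (1 - t)%:E * f y.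

Definition argmin (T : Type) (f : T -> \bar R) : set T :=
  [set x | forall y, f x <= f y].

Section euclidean.
Context {E : euclideanType R}.
Implicit Types (f : E -> \bar R) (x z : E).

Definition proper_closed_convex f : Prop :=
  [/\ proper f, lower_semicontinuous f & econvex f].

Definition strongly_convex (mu : R) f : Prop :=
  econvex (fun x => f x - (mu / 2 * `|x| ^+ 2)%:E).

Definition subdiff f x : set E :=
  [set g : E | forall y, f x + (inner g (y - x))%:E <= f y].

Definition conjugate f (v : E) : \bar R :=
  ereal_sup [set (inner v x)%:E - f x | x in [set: E]].

Definition prox f z : set E :=
  argmin (fun z' : E => f z' + (2^-1 * `|z - z'| ^+ 2)%:E).

Definition is_gradient (F : E -> R) (gradF : E -> E) : Prop :=
  forall x, differentiable F x /\ forall h, 'd F x h = inner (gradF x) h :> R.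

Definition smooth (L : R) (F : E -> R) (gradF : E -> E) : Prop :=
  is_gradient F gradF /\ L.-lipschitz gradF.
End euclidean.

Definition opnorm (E E' : normedModType R) (K : E -> E') : R :=
  sup [set `|K x|%R | x in [set x : E | (`|x| <= 1)%R]].

Definition is_adjoint (E E' : euclideanType R) (K : E -> E') (Ks : E' -> E) :=
  forall x u, inner (K x) u = inner x (Ks u).

Section pd3o.
Context {X U : euclideanType R}.
Variables (F : X -> R) (gradF : X -> X) (Rf : X -> \bar R) (H : U -> \bar R).
Variables (K : X -> U) (Ks : U -> X).

Definition primal_obj (x : X) : \bar R := (F x)%:E + Rf x + H (K x).

Definition dual_obj (u : U) : \bar R :=
  conjugate (fun x => (F x)%:E + Rf x) (- Ks u)%R + conjugate H u.

(* u \in \partial H(Kx)  and  0 \in \partial Rf(x) + gradF(x) + K^* u *)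
Definition kkt (x : X) (u : U) : Prop :=
  subdiff H (K x) u /\ exists2 r, subdiff Rf x r & (r + gradF x + Ks u = 0)%R.

(* prox is set-valued (the set of minimizers), so x, q, u is any sequence
   generated by the algorithm; x 0 plays no role. *)
Definition pd3o_iterates (gamma : nat -> R) (eta : R)
    (x q : nat -> X) (u : nat -> U) : Prop :=
  forall k : nat,
  [/\ prox (fun y => (gamma k)%:E * Rf y)
        (gamma k *: (q k - Ks (u k)))%R (x k.+1),
      q k.+1 = ((gamma k.+1)^-1 *: x k.+1 - gradF (x k.+1))%R
    & prox (fun v => ((gamma k.+1 * eta)^-1)%:E * conjugate H v)
        (u k + eta^-1 *: K ((gamma k)^-1 *: x k.+1 + q k.+1 - q k))%R
        (u k.+1)].
End pd3o.
End convex_analysis.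

(* Main.v *)
Require Import Defs.
From HB Require Import structures.
From mathcomp Require Import all_boot all_order all_algebra.
From mathcomp Require Import all_classical all_reals all_analysis.
From mathcomp Require Import ring lra.
Set Implicit Arguments.
Unset Strict Implicit.
Unset Printing Implicit Defensive.
Import Order.TTheory GRing.Theory Num.Theory.
Import numFieldNormedType.Exports.
Local Open Scope classical_set_scope.
Local Open Scope ring_scope.

(** The proof is a Lyapunov argument for the iterates, preceded by the convex
    duality that links dual solutions with the KKT conditions.

    Duality.  A KKT pair exists by assumption.  Adding up the subgradient
    inequalities of [F], [Rf] and [H] at it gives quadratic growth of the primal
    objective with modulus [muF + muR > 0] ([kkt_growth]), so its primal part is
    the only minimizer.  Its dual part attains the weak duality bound, hence
    there is no duality gap; at any other dual solution both Fenchel-Young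
    inequalities behind weak duality are then equalities, which are the KKT
    conditions ([dual_argmin_kkt]), once a subgradient of [F + Rf] is split into
    the gradient of [F] and a subgradient of [Rf] ([subdiff_smooth_sum]).

    Decrease.  Let [r_k] be the subgradient of [Rf] at [x_(k+1)] supplied by the
    primal proximal step and [r_*] the one at the solution.  From the primal
    update, monotonicity of the two subdifferentials, and cocoercivity and
    strong monotonicity of the gradient, [lyapunov_step] derives, for
    [g = gamma_(k+1)],

      (1 + 2 g muR) / g^2 |x_(k+2) - x_*|^2 + |r_(k+1) - r_*|^2
        + |u_(k+1) - u_*|_P^2
      <= (1 - 2 g muF kappa) / g^2 |x_(k+1) - x_*|^2 + |r_k - r_*|^2
        + |u_k - u_*|_P^2,

    where [|v|_P^2 = eta |v|^2 - |K^* v|^2 >= 0].  The step size is the positive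
    root of the equation saying that the weight of [x_(k+2)] on the left is the
    weight [(1 - 2 g' muF kappa) / g'^2], [g' = gamma_(k+2)], of the next step
    ([stepsize_weight]), so the inequalities chain and the weighted squared
    distance stays below the initial value of the Lyapunov function.

    Rate.  In the variable [t = 1 / gamma] the step-size rule is the quadratic
    recursion [t'^2 - 2 kappa muF t' = t^2 + 2 muR t], which forces at least
    linear growth of [t] ([stepsize_decay]); with the lower bound on
    [1 - 2 gamma muF kappa] that comes from [gamma_0 < 2 (1 - kappa) / LF] and
    [muF <= LF], this is the rate [1 / k^2].  The same lower bound lets the
    factor 2 in the denominator be dropped after enlarging the constant. *)

(** * Inner products and the operator norm *)

Section inner_product.
Context {R : realType} {E : euclideanType R}.
Implicit Types (x y z : E) (a : R).

Lemma innerDr x y z : inner x (y + z) = inner x y + inner x z.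
Proof. by rewrite innerC innerDl ![inner _ x]innerC. Qed.

Lemma innerZr a x y : inner x (a *: y) = a * inner x y.
Proof. by rewrite innerC innerZl innerC. Qed.

Lemma innerNl x y : inner (- x) y = - inner x y.
Proof. by rewrite -scaleN1r innerZl mulN1r. Qed.

Lemma innerNr x y : inner x (- y) = - inner x y.
Proof. by rewrite innerC innerNl innerC. Qed.

Lemma inner0l y : inner 0 y = 0.
Proof. by rewrite -(scale0r y) innerZl mul0r. Qed.

Lemma inner_suml (I : finType) (f : I -> E) y :
  inner (\sum_i f i) y = \sum_i inner (f i) y.
Proof.
elim/big_ind2 : _ => [|x1 r1 x2 r2 <- <-|//]; first exact: inner0l.
by rewrite innerDl.
Qed.

Definition innerE :=
  (@innerDl R E, innerDr, innerNl, innerNr, @innerZl R E, innerZr).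

(** Reduces identities between vectors, which involve several linear maps
    and scalars, to identities between real numbers. *)
Lemma inner_ext x y : (forall z, inner x z = inner y z) -> x = y.
Proof.
move=> xy; apply/eqP; rewrite -subr_eq0 -normr_eq0 -sqrf_eq0 inner_norm.
by rewrite innerDl innerNl xy subrr.
Qed.

(** Cauchy-Schwarz is the triangle inequality for [x + y], squared. *)
Lemma inner_le_norm x y : inner x y <= `|x| * `|y|.
Proof.
have : `|x + y| ^+ 2 <= (`|x| + `|y|) ^+ 2.
  by rewrite ler_sqr ?nnegrE ?addr_ge0 ?normr_ge0 ?ler_normD.
rewrite sqrrD !inner_norm !innerE [inner y x]innerC; lra.
Qed.

Lemma normr_inner_le x y : `|inner x y| <= `|x| * `|y|.
Proof.
rewrite ler_norml inner_le_norm andbT lerNl -innerNl.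
by rewrite (le_trans (inner_le_norm _ _))// normrN.
Qed.

End inner_product.

Section finite_dimension.
Context {R : realType} {E E' : euclideanType R}.

(** Finite dimension enters here only.  The coordinates of [x] in a basis are
    the inner products of [x] with the basis vectors, multiplied by the inverse
    of the Gram matrix, so each of them is at most a constant times [`|x|].
    Without this bound [opnorm K] could be the default value of a supremum. *)
Lemma linear_euclidean_bounded (K : {linear E -> E'}) :
  exists2 M, 0 <= M & forall x, `|K x| <= M * `|x|.
Proof.
pose e := vbasis {:E}.
pose G : 'M[R]_(\dim {:E}) := \matrix_(i, j) inner e`_i e`_j.
(* A combination [v] of basis vectors orthogonal to the basis satisfies
   [inner v v = 0]. *)
have Gunit : G \in unitmx.
  rewrite -row_free_unit; apply: inj_row_free => a aG0.
  pose v := \sum_i a 0 i *: e`_i.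
  have vej (j : 'I_(\dim {:E})) : inner v e`_j = 0.
    move/rowP/(_ j): aG0; rewrite !mxE => aG0j.
    rewrite inner_suml -[RHS]aG0j; apply: eq_bigr => i _.
    by rewrite innerZl mxE.
  have v0 : v = 0.
    apply/eqP; rewrite -normr_eq0 -sqrf_eq0 inner_norm; apply/eqP.
    rewrite {1}/v inner_suml big1// => i _.
    by rewrite innerZl innerC vej mulr0.
  apply/rowP => i; rewrite mxE.
  have /freeP := basis_free (vbasisP {:E}).
  by move=> /(_ (fun i => a 0 i)); apply.
pose c x : 'rV[R]_(\dim {:E}) := \row_i coord e i x.
have xE x : x = \sum_i c x 0 i *: e`_i.
  rewrite {1}(coord_vbasis (memvf x)); apply: eq_bigr => i _.
  by rewrite mxE.
have cE x : c x = (\row_j inner x e`_j) *m invmx G.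
  rewrite -[LHS](mulmxK Gunit); congr (_ *m _).
  apply/rowP => j; rewrite !mxE [in RHS](xE x) inner_suml.
  by apply: eq_bigr => i _; rewrite innerZl !mxE.
exists (\sum_(i < \dim {:E}) \sum_(j < \dim {:E})
          `|e`_j| * `|invmx G j i| * `|K e`_i|).
  by apply: sumr_ge0 => i _; apply: sumr_ge0 => j _; rewrite !mulr_ge0.
move=> x; rewrite {1}(xE x) linear_sum/=.
rewrite (le_trans (ler_norm_sum _ _ _))// mulr_suml ler_sum// => i _.
rewrite linearZ/= normrZ cE mxE -mulr_suml [X in _ <= X]mulrAC.
rewrite ler_wpM2r// (le_trans (ler_norm_sum _ _ _))//.
rewrite mulr_suml ler_sum// => j _; rewrite !mxE normrM.
rewrite [X in _ <= X]mulrAC ler_wpM2r// [X in _ <= X]mulrC.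
exact: normr_inner_le.
Qed.

Lemma opnorm_ge (K : {linear E -> E'}) x : `|x| <= 1 -> `|K x| <= opnorm K.
Proof.
have [M M0 KM] := linear_euclidean_bounded K.
move=> x1; apply: ub_le_sup; last by exists x.
by exists M => _ [y /= y1 <-]; rewrite (le_trans (KM y))// ler_piMr.
Qed.

Lemma opnorm_ge0 (K : {linear E -> E'}) : 0 <= opnorm K.
Proof. by rewrite (le_trans (normr_ge0 (K 0)))// opnorm_ge ?normr0. Qed.

Lemma le_opnorm (K : {linear E -> E'}) x : `|K x| <= opnorm K * `|x|.
Proof.
have [->|x0] := eqVneq x 0; first by rewrite linear0 !normr0 mulr0.
have xp : 0 < `|x| by rewrite normr_gt0.
have xx : `| `|x|^-1 *: x| <= 1.
  by rewrite normrZ normfV normr_id mulVf// gt_eqF.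
rewrite -ler_pdivrMr// (le_trans _ (opnorm_ge K xx))//.
by rewrite linearZ/= normrZ normfV normr_id mulrC.
Qed.

(** Both sides of [|K^* u|^2 = <K K^* u, u> <= ||K|| |K^* u| |u|] carry a factor
    [|K^* u|], so the adjoint inherits the operator norm bound. *)
Lemma le_adjoint_opnorm (K : {linear E -> E'}) (Ks : {linear E' -> E}) u :
  is_adjoint K Ks -> `|Ks u| <= opnorm K * `|u|.
Proof.
move=> adjK; have [->|Ku0] := eqVneq (Ks u) 0.
  by rewrite normr0 mulr_ge0// opnorm_ge0.
have Kup : 0 < `|Ks u| by rewrite normr_gt0.
rewrite -(ler_pM2l Kup) -expr2 inner_norm -adjK.
rewrite (le_trans (inner_le_norm _ _))// mulrA ler_wpM2r//.
by rewrite mulrC le_opnorm.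
Qed.

End finite_dimension.

(** * Smooth convex functions *)

Section smooth_convex.
Context {R : realType} {X : euclideanType R}.
Variables (F : X -> R) (gradF : X -> X).
Implicit Types (x y d : X).

Lemma ler_halvingP (a b c : R) :
  0 <= c -> (forall n, a <= b + 2^-1 ^+ n * c) -> a <= b.
Proof.
move=> c0 abc; apply/ler_addgt0Pr => e e0.
rewrite (le_trans (abc (Num.bound (c / e))))// lerD2l exprVn.
rewrite ler_pdivrMl ?exprn_gt0//; apply/ltW.
rewrite -ltr_pdivrMr// (lt_le_trans (archi_boundP (divr_ge0 c0 (ltW e0))))//.
by rewrite -natrX ler_nat; apply: ltnW; exact: ltn_expl.
Qed.

(** For first-order conditions: compare a point with the points of a segment
    at parameter [t], divide by [t], and let [t] tend to 0. *)
Lemma ler_vanishing (a b c : R) :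
  0 <= c -> (forall t, 0 < t <= 1 -> a <= b + t * c) -> a <= b.
Proof.
move=> c0 abc; apply: (ler_halvingP c0) => n; apply: abc.
by rewrite exprn_gt0//= exprn_ile1//; lra.
Qed.

(** The limit that defines the derivative is taken here once and for all;
    convexity then acts on [gradF] through inequalities along segments. *)
Lemma gradient_le_slope x d (A B : R) : is_gradient F gradF ->
  (forall t, 0 < t <= 1 -> F (x + t *: d) - F x <= t * (A + t * B)) ->
  inner (gradF x) d <= A.
Proof.
move=> gF FAB; have [dF <-] := gF x.
have cF : h^-1 *: (F (h *: d + x) - F x) @[h --> (0:R)^'+] --> 'd F x d.
  apply: cvg_dnbhs_at_right; rewrite -deriveE//.
  exact: (diff_derivable dF).
have cAB : A + t * B @[t --> (0:R)^'+] --> A.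
  rewrite -[X in _ --> X]addr0 -[X in _ --> _ + X](mul0r B).
  apply: cvgD; first exact: cvg_cst.
  apply: cvgMl; apply: cvg_within; exact: nbhs_right_gt.
apply: (ler_cvg_to cF cAB); near=> t.
have t0 : 0 < t by near: t; exact: nbhs_right_gt.
rewrite /= ler_pdivrMl// [t *: d + x]addrC FAB// t0/=.
by near: t; exact: nbhs_right_le.
Unshelve. all: by end_near.
Qed.

Lemma strongly_convex_real mu x y (t : R) : strongly_convex mu (EFin \o F) ->
  0 <= t <= 1 ->
  F (t *: x + (1 - t) *: y)
  <= t * F x + (1 - t) * F y - mu / 2 * (t * (1 - t)) * `|x - y| ^+ 2.
Proof.
move=> Fmu t01; have := Fmu x y t t01.
rewrite /comp -!EFinB -!EFinM -!EFinD lee_fin !inner_norm !innerE.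
rewrite [inner y x]innerC; lra.
Qed.

Lemma strongly_convex_gradient mu x y :
  is_gradient F gradF -> strongly_convex mu (EFin \o F) ->
  F x + inner (gradF x) (y - x) + mu / 2 * `|y - x| ^+ 2 <= F y.
Proof.
move=> gF Fmu; rewrite -lerBrDr -lerBrDl.
apply: (@gradient_le_slope _ _ _ (mu / 2 * `|y - x| ^+ 2)) => // t /andP[t0 t1].
have -> : x + t *: (y - x) = t *: y + (1 - t) *: x.
  by rewrite scalerBr scalerBl scale1r addrCA addrA addrAC.
have /(strongly_convex_real y x Fmu) : 0 <= t <= 1 by rewrite ltW.
lra.
Qed.

Section cocoercivity.
Variables (L mu : R).
Hypotheses (L0 : 0 < L) (mu0 : 0 <= mu) (FL : smooth L F gradF).
Hypothesis Fmu : strongly_convex mu (EFin \o F).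

Lemma smooth_lipschitz x y : `|gradF x - gradF y| <= L * `|x - y|.
Proof. by have [_ lip] := FL; exact: (lip (x, y) (conj I I)). Qed.

Lemma convex_gradient x y : F x + inner (gradF x) (y - x) <= F y.
Proof.
apply: le_trans (strongly_convex_gradient x y FL.1 Fmu).
by rewrite lerDl mulr_ge0 ?sqr_ge0// divr_ge0.
Qed.

(** If the remainder bound holds with constant [C], applying it on the two
    halves of the segment and moving the middle gradient to the endpoint gives
    the constant [1/4 + C/2]; iterating from the crude bound [C = 1] supplied
    by convexity converges to the sharp [1/2]. *)
Lemma descent x d :
  F (x + d) <= F x + inner (gradF x) d + L / 2 * `|d| ^+ 2.
Proof.
have Lip z e : inner (gradF (z + e) - gradF z) e <= L * `|e| ^+ 2.
  rewrite (le_trans (inner_le_norm _ _))// expr2 mulrA ler_wpM2r//.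
  by rewrite (le_trans (smooth_lipschitz _ _))// addrAC subrr add0r.
apply: (@ler_halvingP _ _ (L / 2 * `|d| ^+ 2)).
  by rewrite mulr_ge0 ?sqr_ge0// divr_ge0// ltW.
move=> n; elim: n x d => [|n IH] x d.
  have := convex_gradient (x + d) x; have := Lip x d.
  rewrite opprD addrA subrr add0r !innerE expr0; lra.
have dE : d = 2^-1 *: d + 2^-1 *: d
  by rewrite -scalerDl -[LHS]scale1r; congr (_ *: _); lra.
have := IH x (2^-1 *: d); have := IH (x + 2^-1 *: d) (2^-1 *: d).
have := Lip x (2^-1 *: d).
rewrite -addrA -dE !inner_norm !innerE exprS; lra.
Qed.

(** Comparing the descent upper bound with the convex lower bound at the
    gradient step [y - (grad F y - grad F x) / L]. *)
Lemma cocoercive_half x y :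
  F x + inner (gradF x) (y - x) + (2 * L)^-1 * `|gradF y - gradF x| ^+ 2
  <= F y.
Proof.
set D := gradF y - gradF x.
have gyE : gradF y = gradF x + D by rewrite addrC subrK.
clearbody D.
have := descent y (- L^-1 *: D); have := convex_gradient x (y - L^-1 *: D).
rewrite gyE scaleNr !inner_norm !innerE.
have -> : L / 2 * - - (L^-1 * (L^-1 * inner D D))
          = L^-1 / 2 * inner D D by field; rewrite gt_eqF.
have -> : (2 * L)^-1 = L^-1 / 2 by field; rewrite gt_eqF.
lra.
Qed.

(** Sum of [cocoercive_half] at [(x, y)] and [(y, x)].  The sharp constant
    in [descent] becomes the constant [L] here, hence the range of step sizes up
    to [2 / L]. *)
Lemma cocoercive x y :
  `|gradF y - gradF x| ^+ 2 <= L * inner (gradF y - gradF x) (y - x).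
Proof.
rewrite -ler_pdivrMl//.
have := cocoercive_half x y; have := cocoercive_half y x.
rewrite -[gradF x - _]opprB normrN -(opprB y x) invfM !innerE; lra.
Qed.

Lemma gradient_strongly_monotone x y :
  mu * `|y - x| ^+ 2 <= inner (gradF y - gradF x) (y - x).
Proof.
have := strongly_convex_gradient x y FL.1 Fmu.
have := strongly_convex_gradient y x FL.1 Fmu.
rewrite -(opprB y x) normrN !innerE; lra.
Qed.

(** Strong monotonicity of the gradient against its Lipschitz bound, at [0] and
    a nonzero [x]. *)
Lemma strong_convexity_le_smoothness : (exists x : X, x != 0) -> mu <= L.
Proof.
move=> [x x0]; have x2 : 0 < `|x - 0| ^+ 2.
  by rewrite subr0 exprn_gt0 ?normr_gt0.
rewrite -(ler_pM2r x2) (le_trans (gradient_strongly_monotone 0 x))//.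
rewrite (le_trans (inner_le_norm _ _))// expr2 mulrA ler_wpM2r//.
exact: smooth_lipschitz.
Qed.

End cocoercivity.
End smooth_convex.

(** * Subgradients, proximal points and conjugates *)

Section extended_convex.
Context {R : realType} {E : euclideanType R}.
Variable f : E -> \bar R.
Hypothesis fP : Defs.proper f.
Implicit Types (x y z g : E).
Local Open Scope ereal_scope.

Lemma proper_fin x : f x < +oo -> f x \is a fin_num.
Proof. by move=> fx; rewrite fin_numE fP.1/= -ltey. Qed.

Lemma proper_ex_fin : exists x, f x \is a fin_num.
Proof. by have [_ [x fx]] := fP; exists x; exact: proper_fin. Qed.

Lemma proper_cases x : f x = +oo \/ f x \is a fin_num.
Proof.
have [fx|] := boolP (f x < +oo); first by right; exact: proper_fin.
by rewrite -leNgt leye_eq => /eqP; left.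
Qed.

Lemma subdiff_fin x g : subdiff f x g -> f x \is a fin_num.
Proof.
move=> fg; have [y fy] := proper_ex_fin; apply: proper_fin.
have := fg y; rewrite ltNge leye_eq; apply: contraTN => /eqP ->.
by rewrite -ltNge -(fineK fy) /= ltey.
Qed.

Lemma subdiff_real x g y : subdiff f x g -> f y \is a fin_num ->
  (fine (f x) + inner g (y - x) <= fine (f y))%R.
Proof.
move=> fg fy; have := fg y.
by rewrite -(fineK fy) -(fineK (subdiff_fin fg)) -EFinD lee_fin.
Qed.

Lemma subdiffP x g : f x \is a fin_num ->
  (forall y, f y \is a fin_num ->
    (fine (f x) + inner g (y - x) <= fine (f y))%R) ->
  subdiff f x g.
Proof.
move=> fx fg y; have [->|fy] := proper_cases y; first exact: leey.
by rewrite -(fineK fy) -(fineK fx) -EFinD lee_fin fg.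
Qed.

Lemma econvex_strongly_convex0 : econvex f -> strongly_convex 0 f.
Proof.
move=> fc x y t t01.
by rewrite mul0r !mul0r !sube0; exact: fc.
Qed.

Section strong_convexity.
Variable mu : R.
Hypothesis fmu : strongly_convex mu f.

Lemma strongly_convex_fin x y t : (0 <= t <= 1)%R ->
  f x \is a fin_num -> f y \is a fin_num ->
  f (t *: x + (1 - t) *: y)%R \is a fin_num /\
  (fine (f (t *: x + (1 - t) *: y)) <=
   t * fine (f x) + (1 - t) * fine (f y)
   - mu / 2 * (t * (1 - t)) * `|x - y| ^+ 2)%R.
Proof.
move=> t01 fx fy; have := fmu x y t01.
rewrite -(fineK fx) -(fineK fy) -!EFinB -!EFinM -!EFinD.
have [->|fz] := proper_cases (t *: x + (1 - t) *: y)%R.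
  by rewrite /= leye_eq.
rewrite -(fineK fz) -EFinB lee_fin => h; split => //; move: h => /=.
rewrite !inner_norm !innerE [inner y x]innerC; lra.
Qed.

(** Evaluating the plain subgradient inequality at [x + t (y - x)] and bounding
    the value there by strong convexity leaves the quadratic gain, up to a
    factor [1 - t]. *)
Lemma subdiff_strong x g y : (0 <= mu)%R ->
  subdiff f x g -> f y \is a fin_num ->
  (fine (f x) + inner g (y - x) + mu / 2 * `|y - x| ^+ 2 <= fine (f y))%R.
Proof.
move=> mu0 fg fy; have fx := subdiff_fin fg.
apply: (@ler_vanishing _ _ _ (mu / 2 * `|y - x| ^+ 2)%R).
  by rewrite mulr_ge0 ?sqr_ge0// divr_ge0.
move=> t /andP[t0 t1]; have t01 : (0 <= t <= 1)%R by rewrite ltW.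
have [fz fzle] := strongly_convex_fin t01 fy fx.
have := subdiff_real fg fz.
have -> : (t *: y + (1 - t) *: x - x = t *: (y - x))%R.
  by rewrite scalerBl scale1r scalerBr addrA addrAC addrK.
rewrite innerZr => fzge; rewrite -(ler_pM2l t0); lra.
Qed.

Lemma subdiff_strongly_monotone x g y h : (0 <= mu)%R ->
  subdiff f x g -> subdiff f y h ->
  (mu * `|x - y| ^+ 2 <= inner (g - h) (x - y))%R.
Proof.
move=> mu0 fg fh.
have := subdiff_strong mu0 fg (subdiff_fin fh).
have := subdiff_strong mu0 fh (subdiff_fin fg).
rewrite -(opprB x y) normrN !innerE; lra.
Qed.

End strong_convexity.

(** First-order optimality: compare the minimizer [p] with the points of the
    segment to a competitor [y] and let them return to [p]. *)
Lemma prox_subdiff (c : R) z p : (0 < c)%R -> econvex f ->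
  prox (fun y => c%:E * f y) z p -> subdiff f p (c^-1 *: (z - p))%R.
Proof.
move=> c0 /econvex_strongly_convex0 f0 pmin.
have fp : f p \is a fin_num.
  have [y fy] := proper_ex_fin; have := pmin y.
  rewrite -(fineK fy) -EFinM -EFinD.
  have [->|//] := proper_cases p.
  by rewrite gt0_muley ?lte_fin// addye// leye_eq.
apply: subdiffP => // y fy.
apply: (@ler_vanishing _ _ _ (c^-1 * (2^-1 * `|y - p| ^+ 2))%R).
  by rewrite mulr_ge0// invr_ge0 ltW.
move=> t /andP[t0 t1]; have t01 : (0 <= t <= 1)%R by rewrite ltW.
have [fz fzle] := strongly_convex_fin f0 t01 fy fp.
have := pmin (t *: y + (1 - t) *: p)%R.
rewrite -(fineK fz) -(fineK fp) -!EFinM -!EFinD lee_fin.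
have -> : (z - (t *: y + (1 - t) *: p) = (z - p) - t *: (y - p))%R.
  rewrite scalerBl scale1r scalerBr !opprD !opprK !addrA.
  by congr (_ + _)%R; rewrite addrAC.
move: (z - p)%R (y - p)%R fzle => w d fzle /=.
rewrite !inner_norm !innerE [inner d w]innerC => zmin.
rewrite -(ler_pM2l t0) -(ler_pM2l c0).
have -> : (c * (t * (fine (f p) + c^-1 * inner w d))
           = c * t * fine (f p) + t * inner w d)%R by field; rewrite gt_eqF.
have -> : (c * (t * (fine (f y) + t * (c^-1 * (2^-1 * inner d d))))
           = c * t * fine (f y) + t * t * (2^-1 * inner d d))%R.
  by field; rewrite gt_eqF.
have : (c * fine (f (t *: y + (1 - t) *: p)) <=
        c * (t * fine (f y) + (1 - t) * fine (f p)))%R.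
  by rewrite ler_pM2l// (le_trans fzle)// !mul0r subr0.
lra.
Qed.

End extended_convex.

Section conjugation.
Context {R : realType} {E : euclideanType R}.
Variable f : E -> \bar R.
Hypothesis fP : Defs.proper f.
Implicit Types (x y v w : E).
Local Open Scope ereal_scope.

Lemma fenchel_young v x : (inner v x)%:E - f x <= conjugate f v.
Proof. by apply: ereal_sup_ubound; exists x. Qed.

Lemma conjugate_le v (a : R) :
  (forall x, f x \is a fin_num -> (inner v x - fine (f x) <= a)%R) ->
  conjugate f v <= a%:E.
Proof.
move=> fa; apply: ge_ereal_sup => _ [x _ <-].
have [->|fx] := proper_cases fP x; first by rewrite leNye.
by rewrite -(fineK fx) -EFinB lee_fin fa.
Qed.

Lemma conjugate_gtNy v : conjugate f v != -oo.
Proof.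
have [x fx] := proper_ex_fin fP; have := fenchel_young v x.
rewrite -(fineK fx) -EFinB; apply: contraTneq => ->.
by rewrite leNgt ltNye.
Qed.

Lemma conjugate_fin_le v x : conjugate f v \is a fin_num ->
  f x \is a fin_num -> (inner v x - fine (f x) <= fine (conjugate f v))%R.
Proof.
move=> cf fx; have := fenchel_young v x.
by rewrite -(fineK fx) -EFinB -(fineK cf) lee_fin.
Qed.

Lemma conjugate_convex : econvex (conjugate f).
Proof.
move=> v w t /andP[t0 t1].
have t1' : (0 <= 1 - t)%R by rewrite subr_ge0.
apply: ge_ereal_sup => _ [x _ <-].
have [->|fx] := proper_cases fP x; first by rewrite leNye.
have -> : (inner (t *: v + (1 - t) *: w)%R x)%:E - f x =
  t%:E * ((inner v x)%:E - f x) + (1 - t)%:E * ((inner w x)%:E - f x).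
  rewrite -(fineK fx) -!EFinB -!EFinM -EFinD !innerE; congr EFin; lra.
by apply: leeD; rewrite lee_wpmul2l ?lee_fin// fenchel_young.
Qed.

Lemma conjugate_subdiff x v : subdiff f x v ->
  conjugate f v = (inner v x - fine (f x))%:E.
Proof.
move=> fv; have fx := subdiff_fin fP fv; apply/eqP; rewrite eq_le.
have := fenchel_young v x; rewrite -{1}(fineK fx) -EFinB => ->.
rewrite andbT; apply: conjugate_le => y fy.
have := subdiff_real fP fv fy; rewrite !innerE; lra.
Qed.

Lemma conjugate_subdiff_converse x v : f x \is a fin_num ->
  conjugate f v <= (inner v x - fine (f x))%:E -> subdiff f x v.
Proof.
move=> fx cv; apply: (subdiffP fP) => // y fy.
have := le_trans (fenchel_young v y) cv.
rewrite -{1}(fineK fy) -EFinB lee_fin !innerE; lra.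
Qed.

Lemma conjugate_proper x v : subdiff f x v -> Defs.proper (conjugate f).
Proof.
move=> fv; split; first exact: conjugate_gtNy.
by exists v; rewrite (conjugate_subdiff fv) ltey.
Qed.

(** Equality in Fenchel-Young is symmetric in [x] and [v].  This turns a
    subgradient of [H] into a point of the subdifferential of its conjugate,
    against which a proximal step on the conjugate can be compared. *)
Lemma subdiff_conjugate x v : subdiff f x v -> subdiff (conjugate f) v x.
Proof.
move=> fv; have fx := subdiff_fin fP fv.
apply: (subdiffP (conjugate_proper fv)).
  by rewrite (conjugate_subdiff fv).
move=> w cw; have := conjugate_fin_le cw fx.
rewrite (conjugate_subdiff fv)/= [inner v x]innerC [inner w x]innerC.
by rewrite !innerE; lra.
Qed.

End conjugation.

(** * Optimality conditions and duality *)

Section duality.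
Context {R : realType} {X U : euclideanType R}.
Variables (F : X -> R) (gradF : X -> X) (Rf : X -> \bar R) (H : U -> \bar R).
Variables (K : {linear X -> U}) (Ks : {linear U -> X}) (L muF muR : R).
Hypotheses (adjK : is_adjoint K Ks) (L0 : 0 < L).
Hypotheses (muF0 : 0 <= muF) (muR0 : 0 <= muR).
Hypotheses (FL : smooth L F gradF) (Fmu : strongly_convex muF (EFin \o F)).
Hypotheses (RP : Defs.proper Rf) (Rmu : strongly_convex muR Rf).
Hypothesis HP : Defs.proper H.
Implicit Types (x y : X) (u v : U).

Let G x := ((F x)%:E + Rf x)%E.

Lemma smooth_sum_proper : Defs.proper G.
Proof.
split=> [x|].
  have [e|fx] := proper_cases RP x; first by rewrite /G e addey.
  by rewrite /G -(fineK fx) -EFinD.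
have [x fx] := proper_ex_fin RP; exists x.
by rewrite /G -(fineK fx) -EFinD ltey.
Qed.

Lemma smooth_sum_fin x : (G x \is a fin_num) = (Rf x \is a fin_num).
Proof. by rewrite /G fin_numD. Qed.

Lemma smooth_sum_fine x : Rf x \is a fin_num -> fine (G x) = F x + fine (Rf x).
Proof. by move=> fx; rewrite /G fineD. Qed.

(** Only the first-order behaviour of [F] at [x] matters: along the segment
    from [x] to [y] the descent bound makes the remainder of [F] quadratic. *)
Lemma subdiff_smooth_sum x g :
  subdiff G x g <-> subdiff Rf x (g - gradF x).
Proof.
have GP := smooth_sum_proper; split=> xg.
- have fx : Rf x \is a fin_num by rewrite -smooth_sum_fin (subdiff_fin GP xg).
  apply: (subdiffP RP) => // y fy.
  apply: (@ler_vanishing _ _ _ (L / 2 * `|y - x| ^+ 2)).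
    by rewrite mulr_ge0// divr_ge0// ltW.
  move=> t /andP[t0 t1]; have t01 : 0 <= t <= 1 by rewrite ltW.
  have [fz fzle] := strongly_convex_fin RP Rmu t01 fy fx.
  have fGz : G (t *: y + (1 - t) *: x) \is a fin_num by rewrite smooth_sum_fin.
  have := subdiff_real GP xg fGz; rewrite !smooth_sum_fine//.
  have -> : t *: y + (1 - t) *: x - x = t *: (y - x).
    by rewrite scalerBl scale1r scalerBr addrA addrAC addrK.
  have := descent L0 muF0 FL Fmu x (t *: (y - x)).
  have -> : x + t *: (y - x) = t *: y + (1 - t) *: x.
    by rewrite scalerBr scalerBl scale1r addrCA addrA addrAC.
  have : 0 <= muR / 2 * (t * (1 - t)) * `|y - x| ^+ 2.
    by rewrite !mulr_ge0// ?subr_ge0// ltW.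
  move: (y - x) fzle => d fzle; rewrite normrZ exprMn real_normK ?num_real//.
  rewrite !innerE => h1 h2 h3; rewrite -(ler_pM2l t0); lra.
- have fx := subdiff_fin RP xg.
  apply: (subdiffP GP) => [|y]; rewrite !smooth_sum_fin// => fy.
  rewrite !smooth_sum_fine//.
  have := subdiff_real RP xg fy; have := convex_gradient muF0 FL Fmu x y.
  rewrite !innerE; lra.
Qed.

Lemma kkt_subdiff_smooth_sum x u :
  kkt gradF Rf H K Ks x u <-> subdiff H (K x) u /\ subdiff G x (- Ks u).
Proof.
split=> [[Hu [r Rr ru]]|[Hu Gu]]; split=> //.
  move/eqP: ru; rewrite addr_eq0 => /eqP <-; apply/subdiff_smooth_sum.
  by rewrite addrK.
by exists (- Ks u - gradF x); [exact/subdiff_smooth_sum|rewrite subrK addNr].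
Qed.

Let P := primal_obj F Rf H K.

Lemma primal_fin x :
  (P x \is a fin_num) = (Rf x \is a fin_num) && (H (K x) \is a fin_num).
Proof. by rewrite /P /primal_obj fin_numD smooth_sum_fin. Qed.

Lemma primal_fine x : P x \is a fin_num ->
  fine (P x) = F x + fine (Rf x) + fine (H (K x)).
Proof.
rewrite primal_fin => /andP[fx hx]; rewrite /P /primal_obj fineD//.
  by rewrite smooth_sum_fine.
by rewrite smooth_sum_fin.
Qed.

Lemma primal_proper x : P x \is a fin_num -> Defs.proper P.
Proof.
move=> fx; split=> [y|]; last by exists x; rewrite -(fineK fx) ltey.
rewrite /P /primal_obj; have [e|fy] := proper_cases HP (K y).
  by rewrite e addey//; exact: smooth_sum_proper.1.
by rewrite -(fineK fy) adde_eq_ninfty/= orbF; exact: smooth_sum_proper.1.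
Qed.

Lemma kkt_primal_fin x u : kkt gradF Rf H K Ks x u -> P x \is a fin_num.
Proof.
move=> [Hu [r Rr _]].
by rewrite primal_fin (subdiff_fin RP Rr) (subdiff_fin HP Hu).
Qed.

(** The subgradient inequalities of [F], [Rf] and [H] at a KKT pair add up: the
    linear terms cancel and the two strong convexity terms remain. *)
Lemma kkt_growth x u y : kkt gradF Rf H K Ks x u -> P y \is a fin_num ->
  fine (P x) + (muF + muR) / 2 * `|y - x| ^+ 2 <= fine (P y).
Proof.
move=> xu fy; have fx := kkt_primal_fin xu.
rewrite !primal_fine//; move: fy; rewrite primal_fin => /andP[Ry Hy].
have [Hu [r Rr ru]] := xu.
have := subdiff_real HP Hu Hy; rewrite -linearB innerC adjK.
have := subdiff_strong RP Rmu muR0 Rr Ry.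
have := strongly_convex_gradient x y FL.1 Fmu.
have : inner (r + gradF x + Ks u) (y - x) = 0 by rewrite ru inner0l.
rewrite [inner _ (Ks u)]innerC; move: (y - x) => d.
by rewrite !innerDl; lra.
Qed.

Lemma kkt_argmin_unique x u y : 0 < muF + muR ->
  kkt gradF Rf H K Ks x u -> argmin P y -> y = x.
Proof.
move=> mu0 xu ymin; have fx := kkt_primal_fin xu.
have fy : P y \is a fin_num.
  apply: (proper_fin (primal_proper fx)).
  by rewrite (le_lt_trans (ymin x))// -(fineK fx) ltey.
have := ymin x; rewrite -(fineK fx) -(fineK fy) lee_fin => yx.
have : (muF + muR) / 2 * `|y - x| ^+ 2 <= 0.
  by have := kkt_growth xu fy; lra.
rewrite pmulr_rle0 ?divr_gt0//.
by rewrite exprn_even_le0//= normr_eq0 subr_eq0 => /eqP.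
Qed.

Let D := dual_obj F Rf H Ks.

Lemma weak_duality x v : P x \is a fin_num -> ((- fine (P x))%:E <= D v)%E.
Proof.
move=> fx; rewrite primal_fine//; move: fx; rewrite primal_fin => /andP[Rx Hx].
have Gx : G x \is a fin_num by rewrite smooth_sum_fin.
have := leeD (fenchel_young G (- Ks v) x) (fenchel_young H v (K x)).
apply: le_trans.
rewrite -(fineK Hx) -(fineK Gx) smooth_sum_fine// -!EFinB -EFinD lee_fin.
rewrite [inner v _]innerC adjK innerNl [inner x _]innerC/=; lra.
Qed.

Lemma kkt_dual_value x u : kkt gradF Rf H K Ks x u -> D u = (- fine (P x))%:E.
Proof.
move=> xu; rewrite primal_fine ?(kkt_primal_fin xu)//.
have /kkt_subdiff_smooth_sum[Hu Gu] := xu.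
rewrite /D /dual_obj (conjugate_subdiff smooth_sum_proper Gu).
rewrite (conjugate_subdiff HP Hu) -EFinD; congr EFin.
rewrite smooth_sum_fine -?smooth_sum_fin ?(subdiff_fin smooth_sum_proper Gu)//.
rewrite [inner u _]innerC adjK innerNl [inner x _]innerC/=; lra.
Qed.

Lemma kkt_dual_argmin x u : kkt gradF Rf H K Ks x u -> argmin D u.
Proof.
move=> xu v; rewrite (kkt_dual_value xu); apply: weak_duality.
exact: kkt_primal_fin xu.
Qed.

(** A dual solution attains the value of [u], so the two Fenchel-Young
    inequalities that add up to weak duality must both be equalities. *)
Lemma dual_argmin_kkt x u v :
  kkt gradF Rf H K Ks x u -> argmin D v -> kkt gradF Rf H K Ks x v.
Proof.
move=> xu vmin; have fx := kkt_primal_fin xu.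
have := vmin u; rewrite (kkt_dual_value xu) primal_fine//.
move: fx; rewrite primal_fin => /andP[Rx Hx].
have Gx : G x \is a fin_num by rewrite smooth_sum_fin.
have := fenchel_young G (- Ks v) x; have := fenchel_young H v (K x).
have sub1 := @conjugate_subdiff_converse _ _ _ smooth_sum_proper x (- Ks v) Gx.
have sub2 := @conjugate_subdiff_converse _ _ _ HP (K x) v Hx.
rewrite -{1}(fineK Hx) -{1}(fineK Gx) -!EFinB.
have vK : inner v (K x) = inner (Ks v) x by rewrite innerC adjK innerC.
rewrite /D /dual_obj -/G.
move: sub1 sub2; rewrite smooth_sum_fine// vK innerNl.
case: (conjugate H v) => [b||] //; case: (conjugate G (- Ks v)) => [a||] //.
rewrite -EFinD !lee_fin => sub1 sub2 h1 h2 h3.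
apply/kkt_subdiff_smooth_sum; split; [apply: sub2|apply: sub1]; lra.
Qed.

End duality.

(** * One step of the iteration, in error variables *)

Section lyapunov_step.
Context {R : realType} {X U : euclideanType R}.
Variables (K : {linear X -> U}) (Ks : {linear U -> X}).
Hypothesis adjK : is_adjoint K Ks.

Lemma adjoint_metric_ge0 (eta : R) (v : U) : opnorm K ^+ 2 <= eta ->
  `|Ks v| ^+ 2 <= eta * `|v| ^+ 2.
Proof.
move=> Keta; have := le_adjoint_opnorm v adjK.
rewrite -ler_sqr ?nnegrE ?mulr_ge0 ?opnorm_ge0// exprMn => /le_trans; apply.
by rewrite ler_wpM2r.
Qed.

(** One iteration, with every quantity measured from its value at a KKT pair:
    [x], [x'] are successive primal errors, [r], [r'] the errors of the
    subgradients of the nonsmooth primal term, [d] the error of the gradient of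
    [F] at [x], and [a], [b] successive dual errors.  The equation is the primal
    update, the first inequality the monotonicity of the subdifferential of the
    conjugate of [H].

    Squaring the equation produces on the left
    [|x'|^2 / g^2 + 2 <x', r'> / g + |r'|^2], and on the right the cross term
    [- 2 <x, K^* b> / g].  The dual inequality bounds that term by the decrease
    of [eta |.|^2 - |K^* .|^2] minus [2 <r + d + K^* b, K^* b>], and
    [|d + K^* b|^2 - 2 <r + d + K^* b, K^* b>
     = |d|^2 + |r|^2 - |r + K^* b|^2].
    The remaining [|d|^2] is paid by the fraction [1 - kappa] of
    [2 <d, x> / g] through cocoercivity, since [g L <= 2 (1 - kappa)]; the
    fraction [kappa] contributes through strong monotonicity of the gradient. *)
Lemma lyapunov_step (g L muF muR kappa eta : R)
    (x x' r r' d : X) (a b : U) :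
  0 < g -> 0 < L -> 0 <= kappa -> g * L <= 2 * (1 - kappa) ->
  opnorm K ^+ 2 <= eta ->
  g^-1 *: x' + r' = g^-1 *: x - d - Ks b ->
  0 <= inner (K x + g *: (eta *: (a - b) - K (r + d + Ks a))) b ->
  muR * `|x'| ^+ 2 <= inner r' x' ->
  `|d| ^+ 2 <= L * inner d x ->
  muF * `|x| ^+ 2 <= inner d x ->
  (1 + 2 * g * muR) / g ^+ 2 * `|x'| ^+ 2 + `|r'| ^+ 2
    + (eta * `|b| ^+ 2 - `|Ks b| ^+ 2)
  <= (1 - 2 * g * muF * kappa) / g ^+ 2 * `|x| ^+ 2 + `|r| ^+ 2
    + (eta * `|a| ^+ 2 - `|Ks a| ^+ 2).
Proof.
move=> g0 L0 k0 gL Keta xr' Hmono Rmono Fcoco Fmono.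
have gn0 : g != 0 by rewrite gt_eqF.
have dx0 : 0 <= inner d x.
  by rewrite -(pmulr_rge0 _ L0) (le_trans (sqr_ge0 _) Fcoco).
set n := g^-1 in xr' *; have n0 : 0 < n by rewrite invr_gt0.
have -> : (1 + 2 * g * muR) / g ^+ 2 = n ^+ 2 + 2 * n * muR.
  by rewrite /n; field.
have -> : (1 - 2 * g * muF * kappa) / g ^+ 2 = n ^+ 2 - 2 * n * muF * kappa.
  by rewrite /n; field.
have {}Fcoco : `|d| ^+ 2 <= 2 * (1 - kappa) * n * inner d x.
  rewrite (le_trans Fcoco)// ler_wpM2r// -(ler_pM2l g0).
  by rewrite (le_trans gL)// mulrCA /n divff// mulr1.
have {}Fmono : 0 <= n * kappa * (inner d x - muF * `|x| ^+ 2).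
  by rewrite !mulr_ge0 ?subr_ge0// ltW.
have {}Rmono : 0 <= n * (inner r' x' - muR * `|x'| ^+ 2).
  by rewrite mulr_ge0 ?subr_ge0// ltW.
have {}Hmono : 0 <= n * inner x (Ks b) + eta * (inner a b - inner b b)
    - (inner r (Ks b) + inner d (Ks b) + inner (Ks a) (Ks b)).
  move: Hmono; rewrite !innerE !adjK !innerE -(pmulr_rge0 _ n0).
  rewrite mulrDr [n * (g * _)]mulrA [n * g]mulVf// mul1r => Hmono; lra.
(* Nonnegativity of the dual metric at [a - b] turns the inner product of
   [a - b] with [b] into half a difference of squares. *)
have Pab := adjoint_metric_ge0 (a - b) Keta.
have rb0 : 0 <= `|r + Ks b| ^+ 2 by rewrite sqr_ge0.
have xr2 : inner (n *: x' + r') (n *: x' + r')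
  = inner (n *: x - d - Ks b) (n *: x - d - Ks b) by rewrite xr'.
move: Fcoco Fmono Rmono Hmono Pab rb0 xr2; rewrite linearB/=.
move: (Ks a) (Ks b) => p q; rewrite !inner_norm !innerE.
rewrite [inner d x]innerC [inner r' x']innerC [inner b a]innerC.
rewrite [inner q p]innerC [inner q r]innerC [inner q d]innerC [inner q x]innerC.
lra.
Qed.

End lyapunov_step.

(** * Step sizes *)

Section stepsizes.
Context {R : realType} (muF muR kappa : R) (gamma : nat -> R).
Hypotheses (muF0 : 0 <= muF) (muR0 : 0 <= muR) (mu0 : 0 < muF + muR).
Hypotheses (kappa0 : 0 < kappa).
Hypothesis gamma1 : 0 < gamma 1%N.
Hypothesis gammaS : forall k : nat, (1 <= k)%N ->
       gamma k.+1 =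
         (- (gamma k ^+ 2 * muF * kappa)
          + gamma k * Num.sqrt ((gamma k * muF * kappa) ^+ 2
                                + 1 + 2 * gamma k * muR))
         / (1 + 2 * gamma k * muR).

Lemma stepsize_gt0 k : (1 <= k)%N -> 0 < gamma k.
Proof.
elim: k => // -[//|k] IH _; have {IH} g0 := IH isT.
have gmuR : 0 <= gamma k.+1 * muR by rewrite mulr_ge0// ltW.
rewrite gammaS// divr_gt0//; last by lra.
rewrite addrC subr_gt0 expr2 -!mulrA ltr_pM2l// mulrA.
set A := gamma k.+1 * muF * kappa.
have A0 : 0 <= A by rewrite !mulr_ge0// ltW.
rewrite -[ltLHS](ger0_norm A0) -sqrtr_sqr ltr_sqrt; have := sqr_ge0 A; lra.
Qed.

(** The step-size rule solves the quadratic equation that makes the weight of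
    the new squared distance, as produced by one step, the weight with which
    the next step starts. *)
Lemma stepsize_quadratic k : (1 <= k)%N ->
  gamma k.+1 ^+ 2 * (1 + 2 * gamma k * muR)
  = gamma k ^+ 2 * (1 - 2 * gamma k.+1 * muF * kappa).
Proof.
move=> k1; have g0 := stepsize_gt0 k1; have := gammaS k1.
set h := gamma k.+1; set g := gamma k in g0 *.
have gmuR : 0 <= g * muR by rewrite mulr_ge0// ltW.
set S := Num.sqrt _; set B := 1 + 2 * g * muR => hE.
have B0 : B != 0 by rewrite gt_eqF// /B; lra.
have S2 : S ^+ 2 = (g * muF * kappa) ^+ 2 + B.
  rewrite sqr_sqrtr -?addrA// addr_ge0 ?sqr_ge0//; lra.
have hB : h * B + g ^+ 2 * muF * kappa = g * S by rewrite hE divfK//; ring.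
have : (h * B + g ^+ 2 * muF * kappa) ^+ 2
       = g ^+ 2 * ((g * muF * kappa) ^+ 2 + B) by rewrite hB exprMn S2.
move=> e; apply: (mulfI B0); apply/eqP; rewrite -subr_eq0.
have -> : B * (h ^+ 2 * B) - B * (g ^+ 2 * (1 - 2 * h * muF * kappa))
  = (h * B + g ^+ 2 * muF * kappa) ^+ 2
    - g ^+ 2 * ((g * muF * kappa) ^+ 2 + B) by ring.
by rewrite e subrr.
Qed.

Lemma stepsize_weight k : (1 <= k)%N ->
  (1 + 2 * gamma k * muR) / gamma k ^+ 2
  = (1 - 2 * gamma k.+1 * muF * kappa) / gamma k.+1 ^+ 2.
Proof.
move=> k1; have g0 := stepsize_gt0 k1; have h0 := stepsize_gt0 (leqW k1).
have gn0 : gamma k ^+ 2 != 0 by rewrite expf_neq0// gt_eqF.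
have hn0 : gamma k.+1 ^+ 2 != 0 by rewrite expf_neq0// gt_eqF.
apply/eqP; rewrite eqr_div// mulrC [eqbRHS]mulrC; apply/eqP.
exact: stepsize_quadratic.
Qed.

Lemma stepsize_nonincr k : (1 <= k)%N -> gamma k.+1 <= gamma k.
Proof.
move=> k1; have g0 := stepsize_gt0 k1; have h0 := stepsize_gt0 (leqW k1).
rewrite -ler_sqr ?nnegrE ?(ltW g0) ?(ltW h0)//.
apply: (@le_trans _ _ (gamma k.+1 ^+ 2 * (1 + 2 * gamma k * muR))).
  by rewrite ler_peMr ?sqr_ge0// lerDl !mulr_ge0// ltW.
rewrite stepsize_quadratic// ler_piMr ?sqr_ge0// gerBl !mulr_ge0// ltW//.
Qed.

Lemma stepsize_le1 k : (1 <= k)%N -> gamma k <= gamma 1%N.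
Proof.
elim: k => // -[//|k] IH _.
by rewrite (le_trans (stepsize_nonincr _))// IH.
Qed.

(** In terms of [t = 1 / gamma] the quadratic equation reads
    [t'^2 - 2 kappa muF t' = t^2 + 2 muR t], so [t'^2 >= t^2 + 2 m t] with
    [m = muR + kappa muF > 0] and [t] grows at least linearly. *)
Lemma stepsize_decay :
  exists2 c, 0 < c & forall k, (1 <= k)%N -> c * k%:R * gamma k <= 1.
Proof.
pose t k := (gamma k)^-1.
pose m := muR + kappa * muF.
have m0 : 0 < m.
  have [muFp|] := ltP 0 muF.
    by rewrite ltr_wpDl// mulr_gt0.
  move=> muFn; have muF00 : muF = 0 by apply/eqP; rewrite eq_le muFn muF0.
  by move: mu0; rewrite /m muF00 mulr0 add0r addr0.
have t0 k : (1 <= k)%N -> 0 < t k by move=> /stepsize_gt0 g0; rewrite invr_gt0.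
(* [c <= t] along the sequence, hence [c^2 + 2 c t <= 3 c t <= 2 m t] and
   [(t + c)^2 <= t'^2]. *)
pose c := Num.min (m / 2) (t 1%N).
have c0 : 0 < c by rewrite lt_min divr_gt0//= t0.
have cm : c <= m / 2 by rewrite ge_min lexx.
have ct : c <= t 1%N by rewrite ge_min lexx orbT.
exists c => // k k1; rewrite -ler_pdivlMr ?stepsize_gt0// div1r -/(t k).
elim: k k1 => // -[_ _|k IH _]; first by rewrite mulr1.
have {}IH := IH isT; have tk := t0 k.+1 isT; have tk' := t0 k.+2 isT.
have tt : t k.+1 <= t k.+2.
  by rewrite lef_pV2 ?posrE ?stepsize_gt0// stepsize_nonincr.
have quad : t k.+2 ^+ 2 - 2 * kappa * muF * t k.+2
            = t k.+1 ^+ 2 + 2 * muR * t k.+1.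
  have := @stepsize_weight k.+1 isT; rewrite /t.
  have g0 : gamma k.+1 != 0 by rewrite gt_eqF// stepsize_gt0.
  have g0' : gamma k.+2 != 0 by rewrite gt_eqF// stepsize_gt0.
  move=> e; transitivity ((1 - 2 * gamma k.+2 * muF * kappa) / gamma k.+2 ^+ 2).
    by field.
  by rewrite -e; field.
have ck : c <= t k.+1.
  by rewrite (le_trans _ IH)// ler_peMr ?ler1n// ltW.
rewrite -natr1 mulrDr mulr1 (@le_trans _ _ (t k.+1 + c))// ?lerD2r//.
rewrite -ler_sqr ?nnegrE ?(ltW tk')// ?addr_ge0 ?(ltW tk) ?(ltW c0)//.
have h1 : kappa * muF * t k.+1 <= kappa * muF * t k.+2.
  by rewrite ler_wpM2l// mulr_ge0// ltW.
have h2 : c * c <= c * t k.+1 by rewrite ler_pM2l.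
have h3 : c * t k.+1 <= m / 2 * t k.+1 by rewrite ler_pM2r.
have h4 : 0 <= m * t k.+1 by rewrite mulr_ge0// ltW.
move: quad h1 h2 h3 h4; rewrite /m; lra.
Qed.

(** [w] stands for [1 - gamma muF kappa] or for [1 - 2 gamma muF kappa]. *)
Lemma stepsize_bigO (w : nat -> R) (theta c : R) :
  0 < theta -> (forall k, theta <= w k) -> 0 <= c ->
  (fun k : nat => gamma k.+1 ^+ 2 / w k * c : R^o)
    =O_\oo (fun k : nat => (k%:R ^+ 2)^-1 : R^o).
Proof.
move=> th0 thw c0; have [C C0 Cg] := stepsize_decay; apply/eqO_exP.
exists ((c + 1) / (theta * C ^+ 2)).
  by rewrite divr_gt0 ?mulr_gt0 ?exprn_gt0// ltr_wpDl.
near=> k; have k0 : 0 < k%:R :> R.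
  by rewrite ltr0n; near: k; exact: nbhs_infty_gt.
have wk : 0 < w k by rewrite (lt_le_trans th0).
have g0 := stepsize_gt0 (ltn0Sn k).
have kV0 : 0 <= (k%:R ^+ 2 : R)^-1 by rewrite invr_ge0 sqr_ge0.
have f0 : 0 <= gamma k.+1 ^+ 2 / w k * c.
  by apply: mulr_ge0 => //; rewrite divr_ge0 ?sqr_ge0// ltW.
rewrite !ger0_norm//.
have gk : gamma k.+1 ^+ 2 <= (C ^+ 2 * k%:R ^+ 2)^-1.
  rewrite -exprMn -exprVn ler_sqr ?nnegrE ?invr_ge0 ?(ltW g0)//; last first.
    by rewrite mulr_ge0// ltW.
  rewrite -div1r ler_pdivlMr ?mulr_gt0// mulrC (le_trans _ (Cg k.+1 isT))//.
  by rewrite ler_wpM2r ?(ltW g0)// ler_wpM2l ?(ltW C0)// ler_nat.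
have -> : (c + 1) / (theta * C ^+ 2) * (k%:R ^+ 2)^-1
  = (C ^+ 2 * k%:R ^+ 2)^-1 / theta * (c + 1).
  by field; rewrite !gt_eqF.
apply: ler_pM => //; first by rewrite divr_ge0 ?sqr_ge0// ltW.
  apply: ler_pM => //; first by rewrite sqr_ge0.
    by rewrite invr_ge0 ltW.
  by rewrite lef_pV2 ?posrE.
by rewrite lerDl.
Unshelve. all: by end_near.
Qed.

End stepsizes.

(** * The Lyapunov function of the iterates *)

Section pd3o_lyapunov.
Context {R : realType} {X U : euclideanType R}.
Variables (F : X -> R) (gradF : X -> X) (Rf : X -> \bar R) (H : U -> \bar R).
Variables (K : {linear X -> U}) (Ks : {linear U -> X}).
Variables (L muF muR kappa eta : R) (gamma : nat -> R).
Variables (x q : nat -> X) (u : nat -> U).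
Hypotheses (adjK : is_adjoint K Ks) (L0 : 0 < L) (kappa0 : 0 <= kappa).
Hypotheses (muF0 : 0 <= muF) (muR0 : 0 <= muR).
Hypotheses (FL : smooth L F gradF) (Fmu : strongly_convex muF (EFin \o F)).
Hypotheses (RP : Defs.proper Rf) (Rc : econvex Rf).
Hypothesis Rmu : strongly_convex muR Rf.
Hypotheses (HP : Defs.proper H).
Hypotheses (eta0 : 0 < eta) (Keta : opnorm K ^+ 2 <= eta).
Hypothesis iter : pd3o_iterates gradF Rf H K Ks gamma eta x q u.
Variables (xs : X) (us : U).
Hypothesis xus : kkt gradF Rf H K Ks xs us.

Definition prox_subgradient k : X :=
  q k - Ks (u k) - (gamma k)^-1 *: x k.+1.

Lemma prox_subgradientP k : 0 < gamma k ->
  subdiff Rf (x k.+1) (prox_subgradient k).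
Proof.
move=> g0; have [xk _ _] := iter k; have := prox_subdiff RP g0 Rc xk.
by rewrite scalerBr scalerA mulVf ?scale1r// gt_eqF.
Qed.

Lemma kkt_subgradientP : subdiff Rf xs (- gradF xs - Ks us).
Proof.
have [_ [r Rr ru]] := xus; congr (subdiff _ _ _) : Rr.
by apply/eqP; rewrite -subr_eq0 opprD !opprK addrA ru.
Qed.

(** The proximal step puts a known vector in the subdifferential of the
    conjugate of [H] at [u k.+1], and [K xs] lies in it at [us].  After
    [q k.+1 - q k] is eliminated through [prox_subgradient], their difference
    is the vector paired with [u k.+1 - us] here. *)
Lemma dual_update_monotone k : 0 < gamma k.+1 ->
  0 <= inner (K (x k.+1 - xs) + gamma k.+1 *:
    (eta *: ((u k - us) - (u k.+1 - us))
     - K ((prox_subgradient k - (- gradF xs - Ks us))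
          + (gradF (x k.+1) - gradF xs) + Ks (u k - us))))
    (u k.+1 - us).
Proof.
move=> g0; have [_ qk uk] := iter k; have [Hu _] := xus.
have HcP := conjugate_proper HP Hu.
have ge0 : 0 < (gamma k.+1 * eta)^-1 by rewrite invr_gt0 mulr_gt0.
have Hk := prox_subdiff HcP ge0 (conjugate_convex HP) uk.
have Hs := subdiff_conjugate HP Hu.
have := subdiff_strongly_monotone HcP
  (econvex_strongly_convex0 (conjugate_convex HP)) (lexx 0) Hk Hs.
rewrite mul0r; congr (_ <= inner _ _); apply: inner_ext => z.
rewrite qk invrK /prox_subgradient [Ks (_ - _)]linearB !(innerE, adjK).
move: (gamma k)^-1 => n; field.
by rewrite !gt_eqF.
Qed.

(** The subgradient at [xs] that corresponds to [us] is [- gradF xs - Ks us],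
    so the middle term is the error of [prox_subgradient k].  The last term is
    the squared dual error for the metric [eta - K K^*], which is positive
    semidefinite as [opnorm K ^+ 2 <= eta]. *)
Definition lyapunov k : R :=
  (1 - 2 * gamma k.+1 * muF * kappa) / gamma k.+1 ^+ 2 * `|x k.+1 - xs| ^+ 2
  + `|prox_subgradient k - (- gradF xs - Ks us)| ^+ 2
  + (eta * `|u k - us| ^+ 2 - `|Ks (u k - us)| ^+ 2).

Lemma lyapunov_nonincr k :
  0 < gamma k.+1 -> gamma k.+1 * L <= 2 * (1 - kappa) ->
  (1 + 2 * gamma k.+1 * muR) / gamma k.+1 ^+ 2
    = (1 - 2 * gamma k.+2 * muF * kappa) / gamma k.+2 ^+ 2 ->
  lyapunov k.+1 <= lyapunov k.
Proof.
move=> g0 gL weight; rewrite /lyapunov -weight.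
apply: (lyapunov_step adjK g0 L0 kappa0 gL Keta
          (d := gradF (x k.+1) - gradF xs)).
- apply: inner_ext => z; have [_ qk _] := iter k.
  rewrite /prox_subgradient qk [Ks (_ - _)]linearB !innerE.
  by move: (gamma k.+1)^-1 => n; ring.
- exact: dual_update_monotone.
- exact: (subdiff_strongly_monotone RP Rmu muR0
           (prox_subgradientP g0) kkt_subgradientP).
- exact: cocoercive FL Fmu _ _.
- exact: gradient_strongly_monotone FL Fmu _ _.
Qed.

Lemma lyapunov_bound k : lyapunov k >=
  (1 - 2 * gamma k.+1 * muF * kappa) / gamma k.+1 ^+ 2 * `|x k.+1 - xs| ^+ 2.
Proof.
rewrite /lyapunov -addrA lerDl addr_ge0 ?sqr_ge0// subr_ge0.
exact: adjoint_metric_ge0.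
Qed.

End pd3o_lyapunov.

(** * The convergence rate *)

Theorem theorem3 (R : realType) (X U : euclideanType R)
    (K : {linear X -> U}) (Ks : {linear U -> X}) (hKs : is_adjoint K Ks)
    (F : X -> R) (gradF : X -> X) (Rf : X -> \bar R) (H : U -> \bar R)
    (LF muF muR kappa eta : R) (gamma : nat -> R)
    (hR : proper_closed_convex Rf) (hH : proper_closed_convex H)
    (hLF : 0 < LF) (hFconv : econvex (EFin \o F))
    (hFsmooth : smooth LF F gradF)
    (hmuF0 : 0 <= muF) (hmuR0 : 0 <= muR)
    (hmuF : strongly_convex muF (EFin \o F)) (hmuR : strongly_convex muR Rf)
    (* automatic, hence vacuous here, as soon as X is not the zero space *)
    (hmuFLF : (forall x : X, x = 0) -> muF <= LF)
    (hsol : exists x u, kkt gradF Rf H K Ks x u)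
    (hmu : 0 < muF + muR)
    (xs : X) (hxs : argmin (primal_obj F Rf H K) xs)
    (hkappa : 0 < kappa < 1)
    (hgamma0 : 0 < gamma 0%N < 2 * (1 - kappa) / LF)
    (hgamma1 : gamma 1%N = gamma 0%N)
    (hgamma : forall k : nat, (1 <= k)%N ->
       gamma k.+1 =
         (- (gamma k ^+ 2 * muF * kappa)
          + gamma k * Num.sqrt ((gamma k * muF * kappa) ^+ 2
                                + 1 + 2 * gamma k * muR))
         / (1 + 2 * gamma k * muR))
    (heta0 : 0 < eta) (heta : opnorm K ^+ 2 <= eta)
    (x q : nat -> X) (u : nat -> U)
    (hiter : pd3o_iterates gradF Rf H K Ks gamma eta x q u) :
  [/\ argmin (primal_obj F Rf H K) = [set xs],
      exists us, argmin (dual_obj F Rf H Ks) us,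
      forall us, argmin (dual_obj F Rf H Ks) us <-> kkt gradF Rf H K Ks xs us,
      exists c0 : R,
        [/\ 0 < c0,
            forall k : nat, (1 <= k)%N ->
              `|x k.+1 - xs| ^+ 2
              <= gamma k.+1 ^+ 2 / (1 - gamma k.+1 * muF * kappa) * c0
          & (fun k : nat =>
               gamma k.+1 ^+ 2 / (1 - gamma k.+1 * muF * kappa) * c0 : R^o)
            =O_\oo (fun k : nat => (k%:R ^+ 2)^-1 : R^o)]
    & forall us, argmin (dual_obj F Rf H Ks) us ->
        let c0 := (1 - gamma 0%N * muF * kappa) / gamma 0%N ^+ 2
                    * `|x 1%N - xs| ^+ 2
                  + `|q 0%N - (gamma 0%N)^-1 *: x 1%N
                      - Ks (u 0%N - us) + gradF xs| ^+ 2
                  + eta * `|u 0%N - us| ^+ 2 - `|Ks (u 0%N - us)| ^+ 2 in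
        [/\ 0 <= c0,
            forall k : nat, (1 <= k)%N ->
              `|x k.+1 - xs| ^+ 2
              <= gamma k.+1 ^+ 2 / (1 - 2 * gamma k.+1 * muF * kappa) * c0
          & (fun k : nat =>
               gamma k.+1 ^+ 2 / (1 - 2 * gamma k.+1 * muF * kappa) * c0 : R^o)
            =O_\oo (fun k : nat => (k%:R ^+ 2)^-1 : R^o)]].
Proof.
have [hRproper _ hRconv] := hR; have [hHproper _ _] := hH.
move/andP: hkappa => [kappa0 kappa1]; move/andP: hgamma0 => [g00 g0L].
have [x0 [u0 kkt0]] := hsol.
have xsE := kkt_argmin_unique hKs hmuR0 hFsmooth hmuF hRproper hmuR
  hHproper hmu kkt0 hxs.
move: kkt0; rewrite -xsE => {x0 xsE} kkt0.
have dualP us : argmin (dual_obj F Rf H Ks) us <-> kkt gradF Rf H K Ks xs us.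
  split; last exact: (kkt_dual_argmin hKs hLF hmuF0 hmuR0 hFsmooth hmuF
                        hRproper hmuR hHproper).
  exact: (dual_argmin_kkt hKs hLF hmuF0 hmuR0 hFsmooth hmuF
            hRproper hmuR hHproper kkt0).
have g1 : 0 < gamma 1%N by rewrite hgamma1.
have gpos := stepsize_gt0 hmuF0 hmuR0 kappa0 g1 hgamma.
have gle := stepsize_le1 hmuF0 hmuR0 kappa0 g1 hgamma.
have gL k : (1 <= k)%N -> gamma k * LF <= 2 * (1 - kappa).
  move=> k1; rewrite -ler_pdivlMr// (le_trans (gle k k1))// hgamma1 ltW//.
have muFLF : muF <= LF.
  have [X0|Xn0] := pselect (forall y : X, y = 0); first exact: hmuFLF.
  apply: (strong_convexity_le_smoothness hFsmooth hmuF).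
  by move/existsNP : Xn0 => [y /eqP y0]; exists y.
have gk0 k : (1 <= k)%N -> 0 <= gamma k * muF * kappa.
  by move=> k1; rewrite !mulr_ge0 ?(ltW (gpos k k1))// ltW.
pose theta := 1 - 2 * gamma 1%N * muF * kappa.
have theta0 : 0 < theta.
  (* [gamma_0 muF kappa <= gamma_0 LF kappa < 2 kappa (1 - kappa) <= 1 / 2]. *)
  have : gamma 1%N * muF <= gamma 1%N * LF by rewrite ler_pM2l.
  have : gamma 1%N * LF < 2 * (1 - kappa) by rewrite -ltr_pdivlMr// hgamma1.
  move=> h1 h2; have := le_lt_trans h2 h1; rewrite -(ltr_pM2r kappa0) => h3.
  have := sqr_ge0 (2 * kappa - 1); rewrite /theta; lra.
have thetak k : theta <= 1 - 2 * gamma k.+1 * muF * kappa.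
  rewrite /theta lerD2l lerN2 !ler_wpM2r// ?(ltW kappa0)// ler_wpM2l//.
  exact: gle.
have wpos k : 0 < 1 - 2 * gamma k.+1 * muF * kappa.
  exact: lt_le_trans (thetak k).
pose c0 us := (1 - gamma 0%N * muF * kappa) / gamma 0%N ^+ 2
                    * `|x 1%N - xs| ^+ 2
                  + `|q 0%N - (gamma 0%N)^-1 *: x 1%N
                      - Ks (u 0%N - us) + gradF xs| ^+ 2
                  + eta * `|u 0%N - us| ^+ 2 - `|Ks (u 0%N - us)| ^+ 2.
have c0_ge us : kkt gradF Rf H K Ks xs us ->
    forall k, (1 - 2 * gamma k.+1 * muF * kappa) / gamma k.+1 ^+ 2
              * `|x k.+1 - xs| ^+ 2 <= c0 us.
  move=> xus k.
  apply: le_trans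
    (lyapunov_bound gradF muF kappa gamma x q u hKs heta xs us k) _.
  apply: (@le_trans _ _
    (lyapunov gradF Ks muF kappa eta gamma x q u xs us 0)).
    elim: k => // k; apply: le_trans.
    apply: (lyapunov_nonincr hKs hLF (ltW kappa0) hmuF0 hmuR0 hFsmooth hmuF
      hRproper hRconv hmuR hHproper heta0 heta hiter xus).
    - exact: gpos.
    - exact: gL.
    - exact: (stepsize_weight hmuF0 hmuR0 kappa0 g1 hgamma).
  (* At [gamma 1 = gamma 0] the weight [1 - gamma muF kappa] in the constant is
     at least the weight [1 - 2 gamma muF kappa] of the Lyapunov function. *)
  rewrite /lyapunov /c0 hgamma1 -[leRHS]addrA.
  rewrite lerD2r lerD//; last first.
    rewrite le_eqVlt; apply/orP; left; apply/eqP.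
    congr (`|_| ^+ 2); apply: inner_ext => z.
    by rewrite /prox_subgradient [Ks (_ - us)]linearB !innerE; ring.
  rewrite ler_wpM2r ?sqr_ge0// ler_wpM2r ?invr_ge0 ?sqr_ge0//.
  have := gk0 1%N isT; rewrite hgamma1; lra.
have rate us : kkt gradF Rf H K Ks xs us -> forall k,
    `|x k.+1 - xs| ^+ 2
    <= gamma k.+1 ^+ 2 / (1 - 2 * gamma k.+1 * muF * kappa) * c0 us.
  move=> xus k; have := c0_ge us xus k.
  have g0 := gpos k.+1 isT; have w0 := wpos k.
  set w := 1 - _ in w0 *.
  have wg0 : 0 < w / gamma k.+1 ^+ 2 by rewrite divr_gt0 ?exprn_gt0.
  by rewrite -ler_pdivlMl// invf_div.
have c0_ge0 us : kkt gradF Rf H K Ks xs us -> 0 <= c0 us.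
  move=> xus; apply: le_trans (c0_ge us xus 0%N).
  apply: mulr_ge0; last exact: sqr_ge0.
  by apply: divr_ge0; [exact: ltW|exact: sqr_ge0].
have bigO := @stepsize_bigO _ muF muR kappa gamma hmuF0 hmuR0 hmu kappa0 g1
  hgamma.
split.
- apply/seteqP; split=> [y ymin|_ ->//].
  exact: (kkt_argmin_unique hKs hmuR0 hFsmooth hmuF hRproper hmuR
    hHproper hmu kkt0 ymin).
- by exists u0; apply/dualP.
- exact: dualP.
(* As [theta <= 1 - 2 gamma muF kappa] and [1 - gamma muF kappa <= 1],
   dividing the constant by [theta] absorbs the change of denominator; the
   added 1 makes the constant positive. *)
- pose w k := 1 - gamma k.+1 * muF * kappa.
  have thetaw k : theta <= w k.
    by apply: le_trans (thetak k) _; have := gk0 k.+1 isT; rewrite /w; lra.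
  exists ((c0 u0 + 1) / theta); split.
  + by rewrite divr_gt0// ltr_wpDl// c0_ge0.
  + case=> // k _; apply: le_trans (rate u0 kkt0 k.+1) _.
    have wk : 0 < w k.+1 by apply: lt_le_trans (thetaw _).
    rewrite -[leLHS]mulrA -[leRHS]mulrA.
    apply: ler_wpM2l; first exact: sqr_ge0.
    rewrite [leLHS]mulrC [leRHS]mulrCA.
    apply: ler_pM; rewrite ?c0_ge0 ?invr_ge0 ?(ltW (wpos _))//.
      by rewrite lerDl.
    apply: (@le_trans _ _ theta^-1).
      by rewrite lef_pV2 ?posrE.
    rewrite ler_peMl ?invr_ge0 ?(ltW theta0)//.
    rewrite invf_ge1// /w gerBl; exact: gk0.
  + apply: (bigO w theta) => //.
    by apply: divr_ge0; [rewrite addr_ge0// c0_ge0|exact: ltW].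
- move=> us /dualP xus c; split; first exact: c0_ge0.
  + case=> // k _; exact: rate.
  + apply: (bigO _ theta) => //; exact: c0_ge0.
Qed.
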